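(* Let $N\ge 1$, $\eta=e^{2\pi i/N}$ and $\mathbb{Q}_N=\mathbb{Q}(\eta)$. The $\mathbb{Q}_N$-vector space $\mathcal{MD}_N\subset \mathbb{Q}_N[[q]]$ spanned by all multiple divisor functions $[\mathbf s;\boldsymbol\alpha]$ (including $[\emptyset]=1$) is closed under the ordinary multiplication of formal power series, so that $(\mathcal{MD}_N,\cdot)$ is a $\mathbb{Q}_N$-algebra, and it is bifiltered by weight and depth, i.e. for all $k_1,k_2,d_1,d_2\ge 0$, $$\mathrm{Fil}^{W,L}_{k_1,d_1}(\mathcal{MD}_N)\cdot \mathrm{Fil}^{W,L}_{k_2,d_2}(\mathcal{MD}_N)\subset \mathrm{Fil}^{W,L}_{k_1+k_2,d_1+d_2}(\mathcal{MD}_N).$$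
   Context: $\mathbb N=\{1,2,3,\dots\}$. For $d\ge 0$, $\mathbf s=(s_1,\dots,s_d)\in\mathbb N^d$ and $\boldsymbol\alpha=(\alpha_1,\dots,\alpha_d)\in(\mathbb Z/N\mathbb Z)^d$, the multiple divisor function of level $N$ is $$[\mathbf s;\boldsymbol\alpha]=\frac{1}{(s_1-1)!\cdots(s_d-1)!}\sum_{n\ge1}\Bigg(\sum_{\substack{u_1v_1+\cdots+u_dv_d=n\\ u_1>\cdots>u_d>0,\ v_1,\dots,v_d\ge1}}\eta^{\alpha_1v_1+\cdots+\alpha_dv_d}v_1^{s_1-1}\cdots v_d^{s_d-1}\Bigg)q^n\in\mathbb{Q}_N[[q]],$$ with $[\emptyset]=1$. Its weight is $|\mathbf s|=s_1+\cdots+s_d$ and its depth is $d$. $\mathrm{Fil}^{W}_k(\mathcal{MD}_N)$ is the $\mathbb Q_N$-span of all $[\mathbf s;\boldsymbol\alpha]$ with $|\mathbf s|\le k$, $\mathrm{Fil}^{L}_d(\mathcal{MD}_N)$ the $\mathbb Q_N$-span of all $[\mathbf s;\boldsymbol\alpha]$ of depth $\le d$, and $\mathrm{Fil}^{W,L}_{k,d}=\mathrm{Fil}^W_k\cap\mathrm{Fil}^L_d$ (the span of those with weight $\le k$ and depth $\le d$). *)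

(* Defs.v *)
From HB Require Import structures.
From mathcomp Require Import all_boot all_order all_algebra.
From mathcomp Require Import complex.
From mathcomp Require Import boolp classical_sets reals trigo.

Set Implicit Arguments.
Unset Strict Implicit.
Unset Printing Implicit Defensive.
Import Order.TTheory GRing.Theory Num.Theory.
Local Open Scope classical_set_scope.
Local Open Scope ring_scope.

(* ** Formal power series in one variable *)

(* A record rather than nat -> K, which already carries the pointwise ring
   structure. *)
Record fps (K : Type) := Fps { fps_coef : nat -> K }.

Notation "{ 'fps' K }" := (fps K) (format "{ 'fps'  K }") : type_scope.

HB.instance Definition _ (K : Type) := gen_eqMixin {fps K}.
HB.instance Definition _ (K : Type) := gen_choiceMixin {fps K}.

Section FpsRing.
Variable K : comNzRingType.
Implicit Types f g h : {fps K}.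

Lemma fpsP f g : (forall n, fps_coef f n = fps_coef g n) <-> f = g.
Proof.
split=> [|->//]; case: f g => [f] [g] /= fg.
by congr Fps; apply/funext.
Qed.

Definition fps_zero : {fps K} := Fps (fun=> 0).
Definition fps_opp f : {fps K} := Fps (fun n => - fps_coef f n).
Definition fps_add f g : {fps K} := Fps (fun n => fps_coef f n + fps_coef g n).
Definition fps_one : {fps K} := Fps (fun n => (n == 0%N)%:R).
Definition fps_mul f g : {fps K} :=
  Fps (fun n => \sum_(i < n.+1) fps_coef f i * fps_coef g (n - i)).
Definition fps_scale (a : K) f : {fps K} := Fps (fun n => a * fps_coef f n).

Fact fps_addA : associative fps_add.
Proof. by move=> f g h; apply/fpsP => n /=; rewrite addrA. Qed.
Fact fps_addC : commutative fps_add.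
Proof. by move=> f g; apply/fpsP => n /=; rewrite addrC. Qed.
Fact fps_add0 : left_id fps_zero fps_add.
Proof. by move=> f; apply/fpsP => n /=; rewrite add0r. Qed.
Fact fps_addN : left_inverse fps_zero fps_opp fps_add.
Proof. by move=> f; apply/fpsP => n /=; rewrite addNr. Qed.

HB.instance Definition _ := GRing.isZmodule.Build {fps K}
  fps_addA fps_addC fps_add0 fps_addN.

Fact fps_mulC : commutative fps_mul.
Proof.
move=> f g; apply/fpsP => n /=; rewrite (reindex_inj rev_ord_inj) /=.
by apply: eq_bigr => i _; rewrite (sub_ordK i) mulrC.
Qed.

Fact fps_mulA : associative fps_mul.
Proof.
move=> f g h; rewrite [in RHS]fps_mulC [fps_mul g h]fps_mulC.
apply/fpsP=> n /=.
pose c j k := fps_coef f j * (fps_coef g (n - j - k) * fps_coef h k).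
transitivity (\sum_(j < n.+1) \sum_(k < n.+1 | (k <= n - j)%N) c j k).
  apply: eq_bigr => j _; rewrite big_distrr /=.
  rewrite (big_ord_narrow_leq (leq_subr _ _)) /=.
  by apply: eq_bigr => k _; rewrite /c [fps_coef h k * _]mulrC.
rewrite (exchange_big_dep predT) //=; apply: eq_bigr => k _.
transitivity (\sum_(j < n.+1 | (j <= n - k)%N) c j k).
  apply: eq_bigl => j; rewrite -ltnS -(ltnS j) -!subSn ?leq_ord //.
  by rewrite -subn_gt0 -(subn_gt0 j) -!subnDA addnC.
rewrite (big_ord_narrow_leq (leq_subr _ _)) big_distrr /=.
apply: eq_bigr => j _.
by rewrite /c -!subnDA [(j + k)%N]addnC mulrA [RHS]mulrC.
Qed.

Fact fps_mul1 : left_id fps_one fps_mul.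
Proof.
move=> f; apply/fpsP => n /=; rewrite big_ord_recl /= mul1r subn0.
by rewrite big1 ?addr0 // => i _; rewrite mul0r.
Qed.

Fact fps_mulDl : left_distributive fps_mul fps_add.
Proof.
move=> f g h; apply/fpsP => n /=; rewrite -big_split.
by apply: eq_bigr => i _; rewrite mulrDl.
Qed.

Fact fps_one_neq0 : fps_one != 0.
Proof.
apply/eqP => /(congr1 (fun f => fps_coef f 0)) /= /eqP.
by rewrite oner_eq0.
Qed.

HB.instance Definition _ := GRing.Zmodule_isComNzRing.Build {fps K}
  fps_mulA fps_mulC fps_mul1 fps_mulDl fps_one_neq0.

Fact fps_scaleA a b f : fps_scale a (fps_scale b f) = fps_scale (a * b) f.
Proof. by apply/fpsP => n /=; rewrite mulrA. Qed.
Fact fps_scale1 : left_id 1 fps_scale.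
Proof. by move=> f; apply/fpsP => n /=; rewrite mul1r. Qed.
Fact fps_scaleDr : right_distributive fps_scale +%R.
Proof. by move=> a f g; apply/fpsP => n /=; rewrite mulrDr. Qed.
Fact fps_scaleDl f : {morph fps_scale^~ f : a b / a + b}.
Proof. by move=> a b; apply/fpsP => n /=; rewrite mulrDl. Qed.

HB.instance Definition _ := GRing.Zmodule_isLmodule.Build K {fps K}
  fps_scaleA fps_scale1 fps_scaleDr fps_scaleDl.

Fact fps_scaleAl (a : K) f g : a *: (f * g) = (a *: f) * g.
Proof.
apply/fpsP => n /=; rewrite big_distrr /=.
by apply: eq_bigr => i _; rewrite mulrA.
Qed.

HB.instance Definition _ := GRing.Lmodule_isLalgebra.Build K {fps K} fps_scaleAl.
HB.instance Definition _ := GRing.Lalgebra_isComAlgebra.Build K {fps K}.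

End FpsRing.

Section Span.
Variables (K : nzRingType) (V : lmodType K).

Definition lspan (S : set V) : set V :=
  [set x | exists (m : nat) (c : 'I_m -> K) (v : 'I_m -> V),
     (forall i, S (v i)) /\ x = \sum_(i < m) c i *: v i].

End Span.

(* ** The field Q(e^(2 pi i / N)) *)

Section CyclotomicField.
Variables (R : realType) (N : nat).

Definition etaC : R[i] :=
  let t : R := 2 * pi / N%:R in Complex (cos t) (sin t).

(* The smallest subfield of R[i] containing etaC; it contains Q, as every
   subfield of a field of characteristic 0 does. *)
Definition QN_pred : {pred R[i]} := fun x =>
  `[< forall F : {pred R[i]}, divring_closed F -> etaC \in F -> x \in F >].

Fact QN_divring_closed : divring_closed QN_pred.
Proof.
split.
- by apply/asboolP => F [].
- move=> x y /asboolP xF /asboolP yF; apply/asboolP => F Fdiv eF.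
  by case: (Fdiv) => _ + _; apply; [exact: xF|exact: yF].
- move=> x y /asboolP xF /asboolP yF; apply/asboolP => F Fdiv eF.
  by case: (Fdiv) => _ _; apply; [exact: xF|exact: yF].
Qed.

HB.instance Definition _ :=
  GRing.isDivringClosed.Build R[i] QN_pred QN_divring_closed.

Record QN := MkQN { QN_val : R[i]; _ : QN_val \in QN_pred }.

HB.instance Definition _ := [isSub for QN_val].
HB.instance Definition _ := [Choice of QN by <:].
HB.instance Definition _ := [SubChoice_isSubComUnitRing of QN by <:].
HB.instance Definition _ := [SubComUnitRing_isSubIntegralDomain of QN by <:].
HB.instance Definition _ := [SubIntegralDomain_isSubField of QN by <:].

Fact etaC_in : etaC \in QN_pred.
Proof. by apply/asboolP. Qed.

Definition etaN : QN := MkQN etaC_in.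

End CyclotomicField.

(* ** Multiple divisor functions of level N *)

Section MultipleDivisorFunctions.
Variables (R : realType) (N : nat).
Local Notation K := (QN R N).

(* Bounding u and v by n loses nothing: when d > 0 the other conditions force
   u i <= n and v i <= n. *)
Definition md_index (d n : nat) (u v : {ffun 'I_d -> 'I_n.+1}) : bool :=
  [&& [forall i : 'I_d, forall j : 'I_d, (i < j)%N ==> (u j < u i)%N],
      [forall i, (0 < u i)%N],
      [forall i, (0 < v i)%N] &
      (\sum_(i < d) u i * v i)%N == n].

Definition md_coef (d : nat) (s : 'I_d -> nat) (a : 'I_d -> 'I_N) (n : nat) : K :=
  \sum_(uv : {ffun 'I_d -> 'I_n.+1} * {ffun 'I_d -> 'I_n.+1}
         | md_index uv.1 uv.2)
    (etaN R N ^+ (\sum_(i < d) a i * uv.2 i)%N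
      * \prod_(i < d) (uv.2 i)%:R ^+ (s i).-1).

(* A residue mod N is given by its representative in 'I_N ('Z_N is not Z/NZ
   when N = 1); etaN ^+ a only depends on the residue of a. *)
Definition mdf (d : nat) (s : 'I_d -> nat) (a : 'I_d -> 'I_N) : {fps K} :=
  if d == 0%N then 1 else
    ((\prod_(i < d) ((s i).-1)`!)%N%:R)^-1 *:
      Fps (fun n => if n == 0%N then 0 else md_coef s a n).

Definition md_generators (P : nat -> nat -> Prop) : set {fps K} :=
  [set f | exists (d : nat) (s : 'I_d -> nat) (a : 'I_d -> 'I_N),
     [/\ forall i, (0 < s i)%N, P (\sum_(i < d) s i)%N d & f = mdf s a]].

Definition MD : set {fps K} := lspan (md_generators (fun _ _ => True)).

Definition FilW (k : nat) : set {fps K} :=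
  lspan (md_generators (fun w _ => (w <= k)%N)).

Definition FilL (l : nat) : set {fps K} :=
  lspan (md_generators (fun _ d => (d <= l)%N)).

Definition FilWL (k l : nat) : set {fps K} := FilW k `&` FilL l.

(* Contained in FilWL k l; the converse inclusion is not clear, since the
   generators are linearly dependent. *)
Definition FilWL_span (k l : nat) : set {fps K} :=
  lspan (md_generators (fun w d => (w <= k)%N /\ (d <= l)%N)).

End MultipleDivisorFunctions.

Arguments MD R N : clear implicits.
Arguments FilW R N k : clear implicits.
Arguments FilL R N l : clear implicits.
Arguments FilWL R N k l : clear implicits.
Arguments FilWL_span R N k l : clear implicits.

(* Main.v *)
Require Import Defs.
From HB Require Import structures.
From mathcomp Require Import all_boot all_order all_algebra.
From mathcomp Require Import complex.
From mathcomp Require Import ring zify.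
From mathcomp Require Import functions boolp classical_sets reals trigo.
Import GRing.Theory.
Local Open Scope classical_set_scope.
Local Open Scope ring_scope.

(* For a letter (e, t) put A_{e,t}(u) = sum_(v >= 1) eta^(t v) v^e q^(u v); up
   to the factorials, a multiple divisor function is the nested sum of
   A_1(u_1) ... A_d(u_d) over u_1 > ... > u_d > 0.  Splitting the product of two
   nested sums according to which outermost index is larger, or whether they
   are equal (a Rota-Baxter identity), gives a quasi-shuffle recursion, in which
   the only new object is the product A_{e,s}(u) A_{f,t}(u) of two letters.
   That product is again of the same shape, for the sequence
   m |-> sum_(0 < v < m) eta^(s v) v^e eta^(t (m - v)) (m - v)^f,
   which is a linear combination of the eta^(s m) m^j and eta^(t m) m^j with
   j <= e + f + 1; so weights add up and depths do not increase. *)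

Set Implicit Arguments.
Unset Strict Implicit.
Unset Printing Implicit Defensive.

(** * Linear spans *)

Section LinearSpan.
Variables (K : nzRingType) (V : lmodType K).
Implicit Types (S : set V) (x y : V) (a : K).

Lemma lspan_gen S x : S x -> lspan S x.
Proof.
move=> Sx; exists 1%N, (fun=> 1), (fun=> x); split=> //.
by rewrite big_ord1 scale1r.
Qed.

Lemma lspan0 S : lspan S 0.
Proof. by exists 0%N, (fun=> 0), (fun=> 0); rewrite big_ord0; split=> // -[]. Qed.

Lemma lspanP S a x y : lspan S x -> lspan S y -> lspan S (a *: x + y).
Proof.
move=> [m [c [v [Sv ->]]]] [n [d [w [Sw ->]]]].
exists (m + n)%N,
  (fun i => match fintype.split i with inl j => a * c j | inr j => d j end),
  (fun i => match fintype.split i with inl j => v j | inr j => w j end).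
split=> [i|]; first by case: fintype.split.
rewrite big_split_ord scaler_sumr /=; congr (_ + _); apply: eq_bigr => i _.
  by rewrite (unsplitK (inl i)) scalerA.
by rewrite (unsplitK (inr i)).
Qed.

Lemma lspanD S x y : lspan S x -> lspan S y -> lspan S (x + y).
Proof. by move=> Sx Sy; rewrite -[x]scale1r; apply: lspanP. Qed.

Lemma lspanZ S a x : lspan S x -> lspan S (a *: x).
Proof. by move=> Sx; rewrite -[_ *: _]addr0; apply: lspanP => //; exact: lspan0. Qed.

Lemma lspanB S x y : lspan S x -> lspan S y -> lspan S (x - y).
Proof. by move=> Sx Sy; rewrite addrC -scaleN1r; apply: lspanP. Qed.

Lemma lspan_sum S (I : Type) (r : seq I) (P : pred I) (F : I -> V) :
  (forall i, P i -> lspan S (F i)) -> lspan S (\sum_(i <- r | P i) F i).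
Proof. by move=> SF; apply: big_ind => //; [exact: lspan0|exact: lspanD]. Qed.

End LinearSpan.

(** The common reduction to generators; linearity is a bare hypothesis so that [f] may be an
    anonymous function, such as multiplication by a fixed factor. *)
Lemma lspan_map (K : nzRingType) (V W : lmodType K) (f : V -> W)
    (S : set V) (T : set W) :
  linear f -> (forall x, S x -> lspan T (f x)) ->
  forall x, lspan S x -> lspan T (f x).
Proof.
move=> linf ST x [m [c [v [Sv ->]]]].
have f0 : f 0 = 0.
  by have := linf (-1) 0 0; rewrite scaler0 addr0 scaleN1r addNr.
elim/big_ind: _ => [|y z fy fz|i _]; first by rewrite f0; exact: lspan0.
  by rewrite -[y]scale1r linf; apply: lspanP.
by rewrite -[_ *: _]addr0 linf f0; apply: lspanP; [exact: ST|exact: lspan0].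
Qed.

Lemma lspan_sub (K : nzRingType) (V : lmodType K) (S T : set V) :
  S `<=` lspan T -> lspan S `<=` lspan T.
Proof. exact: (@lspan_map _ _ _ id). Qed.

Lemma lspan_mono (K : nzRingType) (V : lmodType K) (S T : set V) :
  S `<=` T -> lspan S `<=` lspan T.
Proof. by move=> ST; apply: lspan_sub => x /ST; exact: lspan_gen. Qed.

Lemma lspan_mul (K : comNzRingType) (V : comAlgType K) (S T U : set V) :
  (forall x y, S x -> T y -> lspan U (x * y)) ->
  forall x y, lspan S x -> lspan T y -> lspan U (x * y).
Proof.
move=> STU x y Sx Ty.
apply: (@lspan_map _ _ _ ( *%R^~ y) S) (Sx) => [a u v|u Su].
  by rewrite mulrDl scalerAl.
apply: (@lspan_map _ _ _ ( *%R u) T) (Ty) => [a v w|v Tv].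
  by rewrite mulrDr scalerAr.
exact: STU.
Qed.

(** * Quasi-shuffle product of nested sums *)

Section QuasiShuffle.
Variables (K : comNzRingType) (V : comAlgType K) (T : Type).
Variables (A : T -> nat -> V) (wt : T -> nat).

(** The summation index is [u.+1], so the inner sum runs over indices at most [u], strictly below
    the outer one. *)
Fixpoint nested_sum (w : seq T) (M : nat) : V :=
  if w is t :: w' then \sum_(u < M) A t u.+1 * nested_sum w' u else 1.

Definition word_weight (w : seq T) : nat := \sum_(t <- w) wt t.

Definition nested_sums (k l : nat) : set (nat -> V) :=
  [set f | exists w, [/\ (word_weight w <= k)%N, (size w <= l)%N &
                         f = nested_sum w]].

Definition letters (k : nat) : set (nat -> V) :=
  [set f | exists2 t, (wt t <= k)%N & f = A t].

Lemma sum_mul_sum (f g : nat -> V) (M : nat) :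
  (\sum_(u < M) f u) * (\sum_(u < M) g u) =
    \sum_(u < M) f u * (\sum_(i < u) g i)
    + \sum_(u < M) g u * (\sum_(i < u) f i)
    + \sum_(u < M) (f u * g u).
Proof.
elim: M => [|M IH]; first by rewrite !big_ord0 mul0r !addr0.
by rewrite !big_ord_recr /= mulrDl !mulrDr IH; ring.
Qed.

(** Bilinearity reduces this to prepending one letter to one word. A span is allowed for [f] because
    the diagonal term of the quasi-shuffle has a product of two letters there. *)
Lemma nested_sums_cons (k l p : nat) (f x : nat -> V) :
  lspan (letters p) f -> lspan (nested_sums k l) x ->
  lspan (nested_sums (p + k) l.+1) (fun M => \sum_(u < M) f u.+1 * x u).
Proof.
move=> pf klx.
apply: (@lspan_map _ _ _ (fun f M => \sum_(u < M) f u.+1 * x u) (letters p))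
  (pf) => [a g h|{pf}_ [t tp ->]].
  apply/funext => M; rewrite !fctE scaler_sumr -big_split.
  by apply: eq_bigr => u _ /=; rewrite mulrDl scalerAl.
apply: (@lspan_map _ _ _ (fun (x : nat -> V) M => \sum_(u < M) A t u.+1 * x u)
  (nested_sums k l)) (klx) => [a g h|_ [w [wk wl ->]]].
  apply/funext => M; rewrite !fctE scaler_sumr -big_split.
  by apply: eq_bigr => u _ /=; rewrite mulrDr scalerAr.
apply: lspan_gen; exists (t :: w); split=> //.
by rewrite /word_weight big_cons leq_add.
Qed.

Lemma nested_sums_mono (k k' l l' : nat) :
  (k <= k')%N -> (l <= l')%N ->
  lspan (nested_sums k l) `<=` lspan (nested_sums k' l').
Proof.
move=> kk ll; apply: lspan_mono => _ [w [wk wl ->]].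
by exists w; split=> //; [exact: leq_trans kk|exact: leq_trans ll].
Qed.

Lemma nested_sum_mul :
  (forall a b, lspan (letters (wt a + wt b)) (A a * A b)) ->
  forall w w', lspan
    (nested_sums (word_weight w + word_weight w') (size w + size w'))
    (nested_sum w * nested_sum w').
Proof.
move=> AA; elim=> [|a w IHw] w'.
  rewrite (_ : _ * _ = nested_sum w'); last first.
    by apply/funext => M; rewrite fctE /= mul1r.
  by apply: lspan_gen; exists w'; split=> //; rewrite leq_addl.
elim: w' => [|b w' IHw'].
  rewrite (_ : _ * _ = nested_sum (a :: w)); last first.
    by apply/funext => M; rewrite !fctE /= mulr1.
  by apply: lspan_gen; exists (a :: w); split=> //; rewrite leq_addr.
(* The quasi-shuffle recursion: the first and last terms use the outer induction, where the second
   word is arbitrary, the middle one the induction on [w']. *)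
rewrite (_ : _ * _ =
    (fun M => \sum_(u < M) A a u.+1 *
        (nested_sum w * nested_sum (b :: w')) u)
  + (fun M => \sum_(u < M) A b u.+1 *
        (nested_sum (a :: w) * nested_sum w') u)
  + (fun M => \sum_(u < M) (A a * A b) u.+1 *
        (nested_sum w * nested_sum w') u)); last first.
  apply/funext => M; rewrite !fctE /=.
  rewrite (sum_mul_sum (fun u => A a u.+1 * nested_sum w u)
                       (fun u => A b u.+1 * nested_sum w' u)).
  congr (_ + _ + _); apply: eq_bigr => u _; ring.
have letterE t : lspan (letters (wt t)) (A t) by apply: lspan_gen; exists t.
have weightE t v : word_weight (t :: v) = (wt t + word_weight v)%N.
  exact: big_cons.
apply: lspanD; [apply: lspanD|].
- apply: nested_sums_mono (nested_sums_cons (letterE a) (IHw (b :: w'))) => //.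
  by rewrite !weightE addnA.
- apply: nested_sums_mono (nested_sums_cons (letterE b) IHw').
    by rewrite !weightE addnCA.
  by rewrite /= addnS.
- apply: nested_sums_mono (nested_sums_cons (AA a b) (IHw w')).
    by rewrite !weightE addnACA.
  by rewrite /= addnS ltnS leqnSn.
Qed.

End QuasiShuffle.

(** * Convolutions of exponential monomials *)

Section Convolution.
Variables (K : fieldType) (I : Type) (z : I -> K).
Hypothesis natf_neq0 : forall n, n.+1%:R != 0 :> K.
Hypothesis z_neq0 : forall t, z t != 0.

(** The codomain is [K^o] so that sequences form a module. At [m = 0] the value is 1 for [e = 0] and
    0 otherwise. *)
Definition exp_monomial (t : I) (e m : nat) : K^o := z t ^+ m * m%:R ^+ e.

Definition exp_monomials (k : nat) : set (nat -> K^o) :=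
  [set f | exists t e, (e < k)%N /\ f = exp_monomial t e].

Lemma exp_monomials_mono (k k' : nat) : (k <= k')%N ->
  lspan (exp_monomials k) `<=` lspan (exp_monomials k').
Proof.
move=> kk; apply: lspan_mono => _ [t [e [ek ->]]]; exists t, e.
by rewrite (leq_trans ek kk).
Qed.

Lemma exp_monomials_gen (t : I) (e k : nat) : (e < k)%N ->
  lspan (exp_monomials k) (exp_monomial t e).
Proof. by move=> ek; apply: lspan_gen; exists t, e. Qed.

Lemma exp_monomials_mulm (k : nat) (f : nat -> K^o) :
  lspan (exp_monomials k) f ->
  lspan (exp_monomials k.+1) (fun m => m%:R * f m).
Proof.
apply: (@lspan_map _ _ _ (fun (f : nat -> K^o) m => m%:R * f m : K^o)).
  by move=> a g h; apply/funext => m; rewrite !fctE mulrDr scalerAr.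
move=> _ [t [e [ek ->]]]; rewrite (_ : (fun m => _) = exp_monomial t e.+1).
  exact: exp_monomials_gen.
by apply/funext => m; rewrite /exp_monomial exprS mulrCA.
Qed.

Variables s t : I.

(** With exponent [m - v.+1] instead of [m - v], the case [i = 0] is the complete homogeneous
    polynomial of degree [m - 1] in [z s] and [z t], whose product with [z s - z t] telescopes. *)
Definition exp_sum (i m : nat) : K^o :=
  \sum_(v < m) z s ^+ v * z t ^+ (m - v.+1) * v%:R ^+ i.

(* Telescoping of [z s ^+ v * v ^+ i * z t ^+ (m - v)] over [v < m]. *)
Lemma exp_sum_rec (i : nat) :
  (z s - z t) *: exp_sum i =
  exp_monomial s i - (i == 0%N)%:R *: exp_monomial t 0
  - z s *: \sum_(j < i) ('C(i, j)%:R : K) *: exp_sum j.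
Proof.
apply/eqP; rewrite eq_sym subr_eq; apply/eqP/funext => m.
pose f v : K := z s ^+ v * v%:R ^+ i * z t ^+ (m - v).
rewrite fct_sumE !fctE /exp_monomial.
(* The end [v = 0] of the telescope contributes [0 ^+ i], hence only when [i = 0]. *)
transitivity (f m - f 0%N).
  rewrite /f subnn subn0 !expr0 !mulr1 !mul1r expr0n.
  by congr (_ - _); rewrite mulrC.
rewrite -(telescope_sumr f (leq0n m)) big_mkord.
rewrite /exp_sum !scaler_sumr.
under [X in _ = _ + X]eq_bigr => j _ do rewrite fctE !scaler_sumr.
rewrite exchange_big -big_split /=; apply: eq_bigr => v _.
(* The leading term of this expansion, with the subtracted [f v], gives [(z s - z t) *: exp_sum i];
   the lower terms give the sums [exp_sum j]. *)
have E : v.+1%:R ^+ i = v%:R ^+ i + \sum_(j < i) v%:R ^+ j *+ 'C(i, j) :> K.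
  rewrite -addn1 natrD addrC exprDn big_ord_recr /= subnn binn addrC.
  by rewrite mul1r; congr (_ + _); apply: eq_bigr => j _; rewrite expr1n mul1r.
transitivity (z s * z s ^+ v * z t ^+ (m - v.+1)
    * (v%:R ^+ i + \sum_(j < i) v%:R ^+ j *+ 'C(i, j))
  - z s ^+ v * v%:R ^+ i * (z t * z t ^+ (m - v.+1))).
  by rewrite /f E -(subnSK (ltn_ord v)) !exprS; ring.
rewrite mulrDr mulr_sumr addrAC; congr (_ + _).
  by rewrite /GRing.scale /=; ring.
by apply: eq_bigr => j _; rewrite -mulr_natl /GRing.scale /=; ring.
Qed.

(** Strong induction on [i]. If [z s] and [z t] differ, the recursion at [i] is divided by their
    difference. If they agree, the recursion at [i.+1] has zero left-hand side and is solved for its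
    term [j = i], whose coefficient [z t * i.+1] is invertible; this costs one extra degree. *)
Lemma exp_sum_span (i : nat) : lspan (exp_monomials i.+2) (exp_sum i).
Proof.
elim/ltn_ind: i => i IH.
have [eq_st|neq_st] := eqVneq (z s) (z t); last first.
  rewrite -[exp_sum i]scale1r -(mulVf (_ : z s - z t != 0)) ?subr_eq0 //.
  rewrite -scalerA exp_sum_rec; apply: lspanZ; apply: lspanB; last first.
    apply/lspanZ/lspan_sum => j _; apply: lspanZ.
    by apply: exp_monomials_mono (IH j (ltn_ord j)); rewrite !ltnS ltnW.
  by apply: lspanB; [|apply: lspanZ]; apply: exp_monomials_gen.
have := exp_sum_rec i.+1; rewrite eq_st subrr scale0r big_ord_recr /= binSn.
rewrite scalerDr opprD addrA => /eqP; rewrite eq_sym subr_eq0 => /eqP E.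
rewrite -[exp_sum i]scale1r -(mulVf (_ : z t * i.+1%:R != 0)); last first.
  by rewrite mulf_neq0.
rewrite -!scalerA -E scale0r subr0; apply/lspanZ/lspanB.
  exact: exp_monomials_gen.
apply/lspanZ/lspan_sum => j _; apply: lspanZ.
by apply: exp_monomials_mono (IH j (ltn_ord j)); rewrite !ltnS ltnW.
Qed.

(** Induction on [j]: one factor [m - v] is split off; its part [m] leaves the sum, its part [v]
    raises [i]. For [j = 0] the sum is [z t *: exp_sum i]. *)
Lemma convolution_span (i j : nat) : lspan (exp_monomials (i + j).+2)
  (fun m => \sum_(v < m) exp_monomial s i v * exp_monomial t j (m - v)).
Proof.
elim: j i => [|j IH] i.
  rewrite (_ : (fun m => _) = z t *: exp_sum i).
    by rewrite addn0; apply/lspanZ/exp_sum_span.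
  apply/funext => m; rewrite fctE scaler_sumr; apply: eq_bigr => v _.
  rewrite /exp_monomial -(subnSK (ltn_ord v)) exprS /GRing.scale /=.
  by ring.
rewrite (_ : (fun m => _) =
    (fun m => m%:R *
      \sum_(v < m) exp_monomial s i v * exp_monomial t j (m - v))
    - (fun m => \sum_(v < m) exp_monomial s i.+1 v * exp_monomial t j (m - v))).
  apply: lspanB; last by rewrite addnS -addSn; exact: IH.
  by rewrite addnS; apply/exp_monomials_mulm/IH.
apply/funext => m; rewrite !fctE mulr_sumr -sumrB; apply: eq_bigr => v _.
rewrite /exp_monomial !exprS; have /ltnW vm := ltn_ord v.
by rewrite -[in X in _ = X * _ - _](subnK vm) natrD; ring.
Qed.

End Convolution.

(** * Letters as power series *)

Section Dilation.
Variable K : comNzRingType.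
Implicit Types (f g : nat -> K^o) (u n : nat).

Lemma fps_coefD (x y : {fps K}) n :
  fps_coef (x + y) n = fps_coef x n + fps_coef y n.
Proof. by []. Qed.

Lemma fps_coefZ (a : K) (x : {fps K}) n : fps_coef (a *: x) n = a * fps_coef x n.
Proof. by []. Qed.

Lemma fps_coefM (x y : {fps K}) n :
  fps_coef (x * y) n = \sum_(i < n.+1) fps_coef x i * fps_coef y (n - i).
Proof. by []. Qed.

Lemma fps_coef_sum (I : Type) (r : seq I) (P : pred I) (F : I -> {fps K}) n :
  fps_coef (\sum_(i <- r | P i) F i) n = \sum_(i <- r | P i) fps_coef (F i) n.
Proof. by apply: (big_morph (fun x : {fps K} => fps_coef x n)). Qed.

(* The power series [\sum_(v >= 1) f v q ^ (u v)] ([0] for [u = 0]). *)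
Definition dilate f u : {fps K} :=
  Fps (fun n => if (0 < n)%N && (u %| n)%N then f (n %/ u)%N else 0).

Lemma dilate_linear : linear dilate.
Proof.
move=> a f g; apply/funext => u; apply/fpsP => n.
rewrite !fctE fps_coefD fps_coefZ /=.
by case: ifP => // _; rewrite mulr0 addr0.
Qed.

Lemma dilate_coef0 f u n : (n < u)%N -> fps_coef (dilate f u) n = 0.
Proof.
move=> nu /=; case: ifP => // /andP[n0 /(dvdn_leq n0)].
by rewrite leqNgt nu.
Qed.

Lemma sum_multiples u m (h : nat -> K) :
  (0 < u)%N -> (forall i, ~~ (u %| i)%N -> h i = 0) ->
  \sum_(i < (u * m).+1) h i = \sum_(j < m.+1) h (u * j)%N.
Proof.
move=> u0 hu; elim: m => [|m IH]; first by rewrite muln0 !big_ord1 muln0.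
rewrite [RHS]big_ord_recr -IH -!(big_mkord predT) /= mulnS addnC -addSn.
(* Among the [u] indices following [u * m], only the last is a multiple of [u]. *)
rewrite (@big_cat_nat _ _ _ (u * m).+1) ?leq_addr //=; congr (_ + _).
rewrite -{1}[(u * m).+1]add0n big_addn addnC addnK.
case: u u0 hu {IH} => // u _ hu.
rewrite big_nat_recr //= big_nat big1 ?add0r => [|i /andP[_ iu]].
  by congr h; lia.
apply: hu; rewrite addnS -addSn dvdn_addl ?dvdn_mulr //.
by rewrite gtnNdvd.
Qed.

(** The coefficient of [q ^ (u m)] is a convolution over [0 < v < m]. Writing it as the sum over all
    [v < m] minus the term [v = 0] keeps both parts in the span of exponential monomials when [f]
    and [g] are such monomials. *)
Lemma dilate_mul f g : dilate f * dilate g =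
  dilate ((fun m => \sum_(v < m) f v * g (m - v)%N) - f 0%N *: g).
Proof.
apply/funext => u; apply/fpsP => n; rewrite fctE fps_coefM.
have [u0|u0] := posnP u.
  rewrite {u}u0 big1 /= => [|i _]; first by case: n => // n; rewrite dvd0n.
  by case: posnP => [|i0]; rewrite ?mul0r // dvd0n -leqn0 leqNgt i0 mul0r.
have [/dvdnP[m ->]|un] := boolP (u %| n)%N; last first.
  rewrite big1 /= => [|i _]; first by rewrite (negPf un) andbF.
  have [ui|ui] := boolP (u %| i)%N; last by rewrite andbF mul0r.
  rewrite [(u %| n - i)%N](_ : _ = false) ?andbF ?mulr0 //.
  apply: contraNF un => uni; have lein : (i <= n)%N by rewrite -ltnS.
  by rewrite -(subnK lein) dvdn_add.
rewrite mulnC (@sum_multiples u m (fun i => fps_coef (dilate f u) i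
   * fps_coef (dilate g u) (u * m - i))) // => [|i ui]; last first.
  by rewrite /= (negPf ui) andbF mul0r.
rewrite /= muln_gt0 u0 dvdn_mulr //= mulKn //.
under eq_bigr => j _ do
  rewrite -mulnBr !muln_gt0 u0 !dvdn_mulr //= !andbT !mulKn //.
case: m => [|m]; first by rewrite big_ord1 mul0r.
rewrite big_ord_recr subnn /= mulr0 addr0 !fctE !big_ord_recl /= mul0r add0r.
rewrite addrC addKr; apply: eq_bigr => j _.
by rewrite subn_gt0 ltnS /= ltn_ord.
Qed.

End Dilation.

(** * Products of exponential letters and the limit of nested sums *)

Section ExponentialLetters.
Variables (K : fieldType) (I : Type) (z : I -> K).
Hypothesis natf_neq0 : forall n, n.+1%:R != 0 :> K.
Hypothesis z_neq0 : forall t, z t != 0.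

(* The pair [(e, t)] stands for the weight [e + 1] and the root [z t]. *)
Definition exp_letter (p : nat * I) : nat -> {fps K} :=
  dilate (exp_monomial z p.2 p.1).

Definition exp_weight (p : nat * I) : nat := p.1.+1.

(** Dilation is linear, so [convolution_span] carries over; its bound [(i + j).+2] is exactly the
    sum of the two weights. *)
Lemma exp_letter_mul (p r : nat * I) :
  lspan (letters exp_letter exp_weight (exp_weight p + exp_weight r))
    (exp_letter p * exp_letter r).
Proof.
rewrite /exp_letter dilate_mul; set k := (_ + _)%N.
apply: (@lspan_map _ _ _ (@dilate K) (exp_monomials z k)).
- exact: dilate_linear.
- move=> _ [t [e [ek ->]]]; apply: lspan_gen.
  by exists (e, t).
apply: lspanB.
  rewrite /k /exp_weight addSn addnS; exact: convolution_span.
apply: lspanZ; apply: exp_monomials_gen.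
by rewrite /k /exp_weight addSn addnS ltnS leqW ?leq_addl.
Qed.

(** This plays the role of the limit in [M]: by [nested_sum_stable] the coefficient of [q ^ n] is
    constant once [M >= n], since a letter at an index above [n] only has terms of order above
    [n]. *)
Definition fps_diagonal (x : nat -> {fps K}) : {fps K} :=
  Fps (fun n => fps_coef (x n) n).

Lemma fps_diagonal_linear : linear fps_diagonal.
Proof. by move=> a x y; apply/fpsP. Qed.

Lemma nested_sum_stable (w : seq (nat * I)) (n M : nat) : (n <= M)%N ->
  fps_coef (nested_sum exp_letter w M) n = fps_coef (nested_sum exp_letter w n) n.
Proof.
case: w => [//|p w] nM /=; rewrite !fps_coef_sum.
rewrite (@big_ord_widen _ _ _ n M (fun i => fps_coef (exp_letter p i.+1 *
   nested_sum exp_letter w i) n)) //.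
rewrite [RHS]big_mkcond; apply: eq_bigr => u _; case: ltnP => // nu.
rewrite fps_coefM big1 // => i _; rewrite dilate_coef0 ?mul0r //.
by rewrite (leq_trans (ltn_ord i)) // ltnS.
Qed.

(** The diagonal is not multiplicative in general; stability lets the coefficients [i] and [n - i]
    be read at the common bound [n]. *)
Lemma fps_diagonal_mul (w w' : seq (nat * I)) :
  fps_diagonal (nested_sum exp_letter w * nested_sum exp_letter w') =
  fps_diagonal (nested_sum exp_letter w) * fps_diagonal (nested_sum exp_letter w').
Proof.
apply/fpsP => n /=; apply: eq_bigr => i _.
by rewrite !(@nested_sum_stable _ _ n) ?leq_subr // -ltnS.
Qed.

Definition nested_series (k l : nat) : set {fps K} :=
  [set f | exists w, [/\ (word_weight exp_weight w <= k)%N, (size w <= l)%N &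
                         f = fps_diagonal (nested_sum exp_letter w)]].

Lemma nested_series_mul (w w' : seq (nat * I)) :
  lspan (nested_series (word_weight exp_weight w + word_weight exp_weight w')
                       (size w + size w'))
    (fps_diagonal (nested_sum exp_letter w) * fps_diagonal (nested_sum exp_letter w')).
Proof.
rewrite -fps_diagonal_mul; apply: lspan_map (nested_sum_mul exp_letter_mul w w').
  exact: fps_diagonal_linear.
by move=> _ [v [vk vl ->]]; apply: lspan_gen; exists v.
Qed.

End ExponentialLetters.

(** * Nested sums over finite functions *)

Definition decreasing_ffun (d n : nat) (u : {ffun 'I_d -> 'I_n}) : bool :=
  [forall i : 'I_d, forall j : 'I_d, (i < j)%N ==> (u j < u i)%N].

Section FfunCons.
Variables (T : Type) (d : nat).

Definition ffun_cons (p : T * {ffun 'I_d -> T}) : {ffun 'I_d.+1 -> T} :=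
  [ffun i => if unlift ord0 i is Some j then p.2 j else p.1].

Lemma ffun_cons0 p : ffun_cons p ord0 = p.1.
Proof. by rewrite ffunE unlift_none. Qed.

Lemma ffun_consS p i : ffun_cons p (lift ord0 i) = p.2 i.
Proof. by rewrite ffunE liftK. Qed.

Lemma ffun_cons_bij : bijective ffun_cons.
Proof.
exists (fun u : {ffun 'I_d.+1 -> T} => (u ord0, [ffun i => u (lift ord0 i)])).
  move=> [x u]; rewrite ffun_cons0; congr (_, _).
  by apply/ffunP => i; rewrite ffunE ffun_consS.
move=> u; apply/ffunP => i; case: (unliftP ord0 i) => [j|] ->.
  by rewrite ffun_consS ffunE.
by rewrite ffun_cons0.
Qed.

End FfunCons.

(** The head [x] is the largest index; once it is fixed, strict decrease turns the bound on the tail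
    into [x - 1]. *)
Lemma decreasing_ffun_cons (d n M : nat) (x : 'I_n.+1)
    (u : {ffun 'I_d -> 'I_n.+1}) :
  decreasing_ffun (ffun_cons (x, u))
    && [forall i, 0 < ffun_cons (x, u) i <= M]%N =
  (0 < x <= M)%N && (decreasing_ffun u && [forall i, 0 < u i <= x.-1]%N).
Proof.
apply/andP/and3P => [[/forallP dec /forallP le_M]|[x_le /forallP dec /forallP le_x]].
  have := le_M ord0; rewrite ffun_cons0 /= => xM; split=> //.
    apply/forallP => i; apply/forallP => j; apply/implyP => ij.
    have /forallP/(_ (lift ord0 j)) := dec (lift ord0 i).
    by rewrite !ffun_consS => /implyP; apply.
  apply/forallP => i; have := le_M (lift ord0 i).
  have /forallP/(_ (lift ord0 i)) := dec ord0.
  by rewrite ffun_consS ffun_cons0 /=; lia.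
split; apply/forallP => i.
  apply/forallP => j; apply/implyP.
  case: (unliftP ord0 j) => [j'|] -> //; rewrite ffun_consS.
  case: (unliftP ord0 i) => [i'|] ->; rewrite ?ffun_consS ?ffun_cons0 /=.
    by have /forallP/(_ j')/implyP := dec i'.
  by have := le_x j'; lia.
case: (unliftP ord0 i) => [i'|] ->; rewrite ?ffun_consS ?ffun_cons0 //=.
by have := le_x i'; lia.
Qed.

(** The ambient bound [n] is kept apart from [M]: the recursion lowers [M] while the type of [u]
    stays fixed. *)
Lemma nested_sum_ffun (K : comNzRingType) (V : comAlgType K) (T : Type)
    (A : T -> nat -> V) (d : nat) (w : 'I_d -> T) (n M : nat) : (M <= n)%N ->
  nested_sum A [seq w i | i <- enum 'I_d] M =
  \sum_(u : {ffun 'I_d -> 'I_n.+1}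
        | decreasing_ffun u && [forall i, 0 < u i <= M]%N)
    \prod_i A (w i) (u i).
Proof.
elim: d w M => [|d IH] w M Mn.
  rewrite enum_ord0 /= (big_pred1 [ffun=> ord0]) ?big_ord0 // => u.
  rewrite /= [RHS](_ : _ = true); last by apply/eqP/ffunP => -[].
  by apply/andP; split; apply/forallP => -[].
rewrite enum_ordSl /= -map_comp.
rewrite (reindex _ (onW_bij _ (ffun_cons_bij 'I_n.+1 d))) /=.
rewrite (eq_big (fun p : 'I_n.+1 * {ffun 'I_d -> 'I_n.+1} =>
    (0 < p.1 <= M)%N &&
      (decreasing_ffun p.2 && [forall i, 0 < p.2 i <= p.1.-1]%N))
  (fun p => \prod_i A (w i) (ffun_cons (p.1, p.2) i))); last 2 first.
- by move=> [x u]; exact: decreasing_ffun_cons.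
- by move=> [x u].
rewrite -(pair_big_dep (fun x : 'I_n.+1 => (0 < x <= M)%N)
  (fun (x : 'I_n.+1) u => decreasing_ffun u && [forall i, (0 < u i <= x.-1)%N])
  (fun x u => \prod_i A (w i) (ffun_cons (x, u) i))) /=.
(* Dropping the excluded head 0 produces the shifted index [u.+1] of [nested_sum]. *)
rewrite [RHS]big_mkcond big_ord_recl /= add0r -big_mkcond /=.
rewrite (@big_ord_widen _ _ _ M n (fun u => A (w ord0) u.+1 *
  nested_sum A [seq (w \o lift ord0) i | i <- enum 'I_d] u)) //.
apply: eq_bigr => x xM; rewrite IH ?(ltnW (ltn_ord x)) // mulr_sumr.
apply: eq_bigr => u _; rewrite big_ord_recl ffun_cons0.
by congr (_ * _); apply: eq_bigr => i _; rewrite ffun_consS.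
Qed.

(** * Coefficients of products of dilations *)

Section ProductOfDilations.
Variable K : comNzRingType.

Definition fps_eq_upto (n : nat) (x y : {fps K}) : Prop :=
  forall k, (k <= n)%N -> fps_coef x k = fps_coef y k.

Lemma fps_eq_upto_prod n (I : finType) (F G : I -> {fps K}) :
  (forall i, fps_eq_upto n (F i) (G i)) ->
  fps_eq_upto n (\prod_i F i) (\prod_i G i).
Proof.
move=> FG; elim/big_ind2: _ => // x1 x2 y1 y2 e1 e2 k kn.
rewrite !fps_coefM; apply: eq_bigr => i _; rewrite e1 ?e2 //.
  exact: leq_trans (leq_subr _ _) kn.
by apply: leq_trans kn; rewrite -ltnS.
Qed.

Definition fps_Xn (k : nat) : {fps K} := Fps (fun n => (n == k)%:R).

Lemma fps_XnD j k : fps_Xn (j + k) = fps_Xn j * fps_Xn k.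
Proof.
apply/fpsP => n; rewrite fps_coefM /=.
have [jn|nj] := leqP j n; last first.
  rewrite big1 => [|i _]; first by rewrite ltn_eqF // ltn_addr.
  by rewrite ltn_eqF ?mul0r // (leq_trans _ nj) // ltn_ord.
rewrite (bigD1 (Ordinal (jn : (j < n.+1)%N))) //= eqxx mul1r big1 ?addr0.
  by congr (_%:R); congr nat_of_bool; lia.
by move=> i ij; rewrite [(_ == j)](negPf ij) mul0r.
Qed.

Lemma dilate_upto (f : nat -> K^o) (u n : nat) : (0 < u)%N ->
  fps_eq_upto n (dilate f u)
    (\sum_(v < n.+1 | (0 < v)%N) (f v : K) *: fps_Xn (u * v)).
Proof.
move=> u0 k kn; rewrite fps_coef_sum /=.
case: ifP => [/andP[k0 /dvdnP[m kE]]|nuk].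
  have m0 : (0 < m)%N by case: m kE => // kE; rewrite kE in k0.
  have mn : (m < n.+1)%N.
    by rewrite ltnS (leq_trans _ kn) // kE leq_pmulr.
  rewrite (bigD1 (Ordinal mn)) //= kE mulnK // mulnC eqxx mulr1.
  rewrite big1 ?addr0 // => v /andP[_ vm].
  rewrite eqn_pmul2l // [(m == v)](_ : _ = false) ?mulr0 //.
  by rewrite eq_sym; apply: negPf vm.
rewrite big1 // => v v0; rewrite [(k == _)](_ : _ = false) ?mulr0 //.
by apply: contraFF nuk => /eqP->; rewrite muln_gt0 u0 v0 dvdn_mulr.
Qed.

(** Only orders up to [n] matter, so each dilation may be replaced by a polynomial, and
    distributivity turns the product into a sum over choices of [v]. *)
Lemma prod_dilate_coef (d n : nat) (f : 'I_d -> nat -> K^o) (u : 'I_d -> nat) :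
  (forall i, (0 < u i)%N) ->
  fps_coef (\prod_i dilate (f i) (u i)) n =
  \sum_(v : {ffun 'I_d -> 'I_n.+1}
        | [forall i, 0 < v i]%N && (\sum_i u i * v i == n)%N)
    \prod_i (f i (v i) : K).
Proof.
move=> u0.
rewrite (@fps_eq_upto_prod n _ _ (fun i =>
  \sum_(v < n.+1 | (0 < v)%N) (f i v : K) *: fps_Xn (u i * v))) //; last first.
  by move=> i; apply: dilate_upto.
rewrite bigA_distr_big fps_coef_sum big_mkcondr /=.
apply: eq_big => [v|v _].
  by apply/ffun_onP/forallP.
rewrite scaler_prod fps_coefZ -(big_morph _ fps_XnD (erefl _)) /= eq_sym.
by case: eqP; rewrite (mulr0, mulr1).
Qed.

End ProductOfDilations.

(** * Multiple divisor functions *)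

Section MultipleDivisor.
Variables (R : realType) (N : nat).
Local Notation K := (QN R N).

Lemma QN_natf_neq0 n : n.+1%:R != 0 :> K.
Proof.
rewrite -(inj_eq val_inj) rmorph_nat rmorph0.
by rewrite Num.Theory.pnatr_eq0.
Qed.

Lemma etaN_neq0 : etaN R N != 0.
Proof.
apply/eqP => /(congr1 val) /= /eqP; rewrite eq_complex /= => /andP[/eqP c0 /eqP s0].
have /eqP := cos2Dsin2 (2 * pi / N%:R : R).
by rewrite c0 s0 expr0n addr0 eq_sym oner_eq0.
Qed.

Definition eta_pow (t : 'I_N) : K := etaN R N ^+ t.

Lemma eta_pow_neq0 t : eta_pow t != 0.
Proof. exact/expf_neq0/etaN_neq0. Qed.

Definition md_word d (s : 'I_d -> nat) (a : 'I_d -> 'I_N) : seq (nat * 'I_N) :=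
  [seq ((s i).-1, a i) | i <- enum 'I_d].

(** Truncation at [M = n] matches the bound ['I_n.+1] built into [md_index]. *)
Lemma md_coef_nested_sum d (s : 'I_d -> nat) (a : 'I_d -> 'I_N) n :
  md_coef R s a n =
  fps_coef (nested_sum (exp_letter eta_pow) (md_word s a) n) n.
Proof.
rewrite (@nested_sum_ffun _ _ _ _ _ (fun i => ((s i).-1, a i)) n) //.
rewrite fps_coef_sum /md_coef.
pose D := @decreasing_ffun d n.+1.
transitivity (\sum_(u | D u && [forall i, 0 < u i <= n]%N)
  \sum_(v : {ffun 'I_d -> 'I_n.+1}
    | [forall i, 0 < v i]%N && (\sum_i u i * v i == n)%N)
    \prod_i (exp_monomial eta_pow (a i) (s i).-1 (v i) : K)).
  rewrite pair_big_dep; apply: eq_big => [uv|uv _].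
    rewrite /md_index -!andbA; congr (_ && _); congr (_ && _).
    by apply: eq_forallb => i; rewrite leq_ord andbT.
  rewrite expr_sum -big_split /=; apply: eq_bigr => i _.
  by rewrite /exp_monomial /eta_pow exprM.
apply: eq_bigr => u /andP[_ /forallP u0]; rewrite prod_dilate_coef // => i.
by have /andP[] := u0 i.
Qed.

Lemma mdf_nested_sum d (s : 'I_d -> nat) (a : 'I_d -> 'I_N) :
  mdf R s a = ((\prod_(i < d) ((s i).-1)`!)%N%:R)^-1 *:
    fps_diagonal (nested_sum (exp_letter eta_pow) (md_word s a)).
Proof.
case: d s a => [|d] s a; rewrite /mdf /=.
  rewrite big_ord0 invr1 scale1r /md_word enum_ord0.
  by apply/fpsP.
congr (_ *: _); apply/fpsP => n /=; rewrite md_coef_nested_sum.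
(* The constant coefficient vanishes: for a nonempty word the nested sum with [M = 0] is empty. *)
by case: n => //; rewrite /md_word enum_ordSl /= big_ord0.
Qed.

Lemma mdf_fact_neq0 d (s : 'I_d -> nat) :
  (\prod_(i < d) ((s i).-1)`!)%N%:R != 0 :> K.
Proof.
have : (0 < \prod_(i < d) ((s i).-1)`!)%N by apply: prodn_gt0 => i; exact: fact_gt0.
by case: (\prod_(i < d) _)%N => // n _; exact: QN_natf_neq0.
Qed.

Lemma md_word_weight d (s : 'I_d -> nat) (a : 'I_d -> 'I_N) :
  (forall i, 0 < s i)%N ->
  word_weight (@exp_weight _) (md_word s a) = (\sum_(i < d) s i)%N.
Proof.
move=> s0; rewrite /word_weight big_map big_enum /=.
by apply: eq_bigr => i _; rewrite /exp_weight prednK.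
Qed.

Lemma md_word_size d (s : 'I_d -> nat) (a : 'I_d -> 'I_N) :
  size (md_word s a) = d.
Proof. by rewrite size_map size_enum_ord. Qed.

Lemma md_word_surj (w : seq (nat * 'I_N)) :
  md_word (fun i => (tnth (in_tuple w) i).1.+1)
          (fun i => (tnth (in_tuple w) i).2) = w.
Proof.
rewrite -[RHS](map_tnth_enum (in_tuple w)); apply: eq_map => i /=.
by rewrite -surjective_pairing.
Qed.

(** The way back from words: each one is some [md_word], and the product of factorials is
    invertible. *)
Lemma nested_series_md_generators (k l : nat) (P : nat -> nat -> Prop) :
  (forall k' l', (k' <= k)%N -> (l' <= l)%N -> P k' l') ->
  nested_series eta_pow k l `<=` lspan (@md_generators R N P).
Proof.
move=> kP _ [w [wk wl ->]].
pose s i := (tnth (in_tuple w) i).1.+1; pose a i := (tnth (in_tuple w) i).2.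
have -> : w = md_word s a by rewrite md_word_surj.
rewrite -[fps_diagonal _]scale1r -(mulfV (mdf_fact_neq0 s)) -scalerA.
rewrite -mdf_nested_sum; apply/lspanZ/lspan_gen; exists (size w), s, a.
split=> //; apply: kP => //; rewrite -(md_word_weight a) //.
by rewrite /s /a md_word_surj.
Qed.

(** The conditions on weight and depth stay abstract so that one argument serves the whole space,
    both filtrations and the joint span. *)
Lemma lspan_md_generators_mul (P1 P2 P : nat -> nat -> Prop) :
  (forall k1 l1 k2 l2 k l, P1 k1 l1 -> P2 k2 l2 ->
     (k <= k1 + k2)%N -> (l <= l1 + l2)%N -> P k l) ->
  forall f g : {fps K}, lspan (md_generators P1) f ->
    lspan (md_generators P2) g -> lspan (md_generators P) (f * g).
Proof.
move=> PP; apply: lspan_mul => _ _ [d [s [a [s0 Ps ->]]]] [e [t [b [t0 Pt ->]]]].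
rewrite !mdf_nested_sum -scalerAl -scalerAr; do 2!apply: lspanZ.
apply: lspan_sub (nested_series_mul QN_natf_neq0 eta_pow_neq0 _ _).
apply: nested_series_md_generators => k l.
by rewrite !md_word_weight // !md_word_size; exact: PP.
Qed.

End MultipleDivisor.

Theorem theorem6p5 (R : realType) (N : nat) (hN : (1 <= N)%N) :
  [/\ GRing.subalg_closed [in MD R N],
      forall k1 k2 d1 d2 : nat,
        [set f * g | f in FilWL R N k1 d1 & g in FilWL R N k2 d2]
          `<=` FilWL R N (k1 + k2) (d1 + d2)
    & forall k1 k2 d1 d2 : nat,
        [set f * g | f in FilWL_span R N k1 d1 & g in FilWL_span R N k2 d2]
          `<=` FilWL_span R N (k1 + k2) (d1 + d2)].
Proof.
split=> [|k1 k2 d1 d2 _ [f [fW fL]] [g [gW gL]] <-|k1 k2 d1 d2 _ [f Wf] [g Wg] <-].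
- split; rewrite ?inE.
  + apply: lspan_gen; exists 0%N, (fun=> 0%N),
      (fun i : 'I_0 => False_rect _ (notF (ltn_ord i))).
    by split=> // -[].
  + by move=> a f g; rewrite !inE; exact: lspanP.
  + by move=> f g; rewrite !inE; exact: lspan_md_generators_mul.
(* The intersection is treated one filtration at a time, without comparing it to [FilWL_span]. *)
- split; [apply: lspan_md_generators_mul fW gW|apply: lspan_md_generators_mul fL gL].
    by move=> *; lia.
  by move=> *; lia.
- apply: lspan_md_generators_mul Wf Wg => w1 l1 w2 l2 w l [? ?] [? ?] ? ?.
  by split; lia.
Qed.
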